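(* Let $s\ge 1$ be an integer and fix the constant $c>0$ in the definition of $\mathcal{S}_{2,s}^*(\mathbb{Z};H)$ given in the context. Then $$\#\mathcal{S}_{2,s}^*(\mathbb{Z};H)\ll H^{2s+o(1)}\qquad (H\to\infty),$$ i.e. for every $\varepsilon>0$ there is a constant $C>0$ depending only on $s$, $c$ and $\varepsilon$ such that $\#\mathcal{S}_{2,s}^*(\mathbb{Z};H)\le C H^{2s+\varepsilon}$ for all real $H\ge 1$.
   Context: For a $(2\times 2)$-matrix $A=(a_{ij})$ with integer entries, $\mathcal{H}(A)=\max(1,\max_{i,j}|a_{ij}|)$ is the multiplicative height of the projective point $(1:a_{11}:a_{12}:a_{21}:a_{22})$. $\mathcal{S}_2(\mathbb{Z};H)$ is the set of symmetric $(2\times 2)$-matrices $A$ with integer entries, $\det A\neq 0$ and $\mathcal{H}(A)\le cH$, where $c>0$ is a fixed constant (the paper writes $\mathcal{H}(A)\ll H$). A tuple $(A_1,\ldots,A_t)$ of invertible matrices is multiplicatively dependent if there are integers $(k_1,\ldots,k_t)\ne(0,\ldots,0)$ with $A_1^{k_1}\cdots A_t^{k_t}=I_2$. $\mathcal{S}_{2,s}^*(\mathbb{Z};H)$ is the set of multiplicatively dependent $s$-tuples of matrices from $\mathcal{S}_2(\mathbb{Z};H)$ such that no subtuple (i.e. $t$-tuple with $1\le t<s$ arising by cancelling components, keeping the order) is multiplicatively dependent. *)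

(* Defs.v *)
From HB Require Import structures.
From mathcomp Require Import all_boot all_order all_algebra.
From mathcomp Require Import finmap.
From mathcomp Require Import all_classical all_reals exp.

Set Implicit Arguments.
Unset Strict Implicit.
Unset Printing Implicit Defensive.

Import Order.TTheory GRing.Theory Num.Theory.
Local Open Scope classical_set_scope.
Local Open Scope ring_scope.

Definition mx_height (A : 'M[int]_2) : nat :=
  maxn 1 (\max_(i < 2) \max_(j < 2) `|A i j|%N).

Definition sym_mx2 (R : realType) (c H : R) : set 'M[int]_2 :=
  [set A | [/\ A^T = A, \det A != 0 & (mx_height A)%:R <= c * H]].

(* Powers with negative exponents are taken in the ring of rational matrices;
   on a singular matrix the ring inverse is a junk value, so this is
   meaningful only for tuples of matrices with nonzero determinant.
   The product is noncommutative, in the order of the tuple. *)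
Definition mult_dependent (t : nat) (A : t.-tuple 'M[int]_2) : Prop :=
  exists k : 'I_t -> int,
    (exists i, k i != 0) /\
    \prod_(i < t) (map_mx intr (tnth A i) : 'M[rat]_2) ^ k i = 1.

Definition min_mult_dependent (R : realType) (s : nat) (c H : R) :
    set (s.-tuple 'M[int]_2) :=
  [set A | [/\ forall i, sym_mx2 c H (tnth A i),
               mult_dependent A
             & forall (t : nat) (B : t.-tuple 'M[int]_2),
                 (1 <= t < s)%N -> subseq B A -> ~ mult_dependent B]].

Arguments min_mult_dependent {R} s c H.

(* Main.v *)
Require Import Defs.
From mathcomp Require Import all_boot all_order all_algebra.
From mathcomp Require Import finmap.
From mathcomp Require Import all_classical all_reals exp.
From mathcomp Require Import zify ring lra.

Set Implicit Arguments.
Unset Strict Implicit.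
Unset Printing Implicit Defensive.

Import Order.TTheory GRing.Theory Num.Theory.
Local Open Scope classical_set_scope.
Local Open Scope ring_scope.

(** Only determinants matter.  Suppose that a tuple [A] of nonsingular matrices
    satisfies a relation [A_1 ^ k_1 * ... * A_s ^ k_s = 1].  By minimality all
    the exponents [k_i] are nonzero, since dropping the trivial factors would
    leave a dependent subtuple.  Taking absolute values of determinants and
    moving the negative exponents to the other side, the product of the
    [|det A_i| ^ |k_i|] over positive exponents equals the same product over
    negative exponents, so both sides have the same prime divisors.  Calling
    [J] the less numerous of the two sides, [2 * #|J| <= s] and, for [i]
    outside [J], every prime divisor of [det A_i] divides
    [Q = \prod_(j in J) |det A_j|] ([min_mult_dependent_supp]).

    It remains to count.  With entries at most [B] and [W = 2 B + 1], there are
    at most [W ^ 3] symmetric matrices, so at most [W ^ (3 #|J|)] choices for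
    the entries indexed by [J].  Once these are chosen, [Q] is a fixed integer
    of size [W ^ O(1)], and only [W ^ o(1)] integers up to [W ^ 2] are composed
    of the primes of [Q] ([covered_pi_nat]).  For each admissible value [D] of
    the determinant there are only [W ^ (1 + o(1))] symmetric matrices of
    determinant [a c - b ^ 2 = D]: the entry [b] is free, and [a] divides
    [D + b ^ 2], the remaining case [a c = 0] being counted directly
    ([covered_sym_det]).  So each index outside [J] contributes
    [W ^ (1 + o(1))] and the total is
    [W ^ (3 #|J| + (s - #|J|) + o(1))], which is at most [W ^ (2 s + o(1))]
    because [2 * #|J| <= s].

    The [o(1)] terms come in the form [rootn k (M * W ^ O(1))] with [M]
    depending on [k] only, and the theorem follows by taking [k] large in terms
    of [s] and [eps]. *)

(** * Covering sets by short lists *)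

(** A list containing [A] gives at once finiteness and a bound on the
    cardinal, and composes well under images, unions and products; the list may
    have elements outside [A], which spares deciding membership. *)
Definition covered (T : eqType) (A : set T) (n : nat) : Prop :=
  exists2 r : seq T, (size r <= n)%N & forall x, A x -> x \in r.

Lemma covered_sub (T : eqType) (A B : set T) (m n : nat) :
  A `<=` B -> (m <= n)%N -> covered B m -> covered A n.
Proof.
move=> AB mn [r rm Br]; exists r; first exact: leq_trans rm mn.
by move=> x /AB /Br.
Qed.

Lemma covered_image (T U : eqType) (f : T -> U) (A : set T) (n : nat) :
  covered A n -> covered (f @` A) n.
Proof.
move=> [r rn Ar]; exists [seq f x | x <- r]; first by rewrite size_map.
by move=> _ [x Ax <-]; apply/map_f/Ar.
Qed.

Lemma covered_setU (T : eqType) (A B : set T) (m n : nat) :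
  covered A m -> covered B n -> covered (A `|` B) (m + n).
Proof.
move=> [r rm Ar] [u un Bu]; exists (r ++ u).
  by rewrite size_cat leq_add.
by move=> x [/Ar xr|/Bu xu]; rewrite mem_cat ?xr ?xu ?orbT.
Qed.

(** This is the form in which successive choices are counted: [m] ways for a
    first datum [i], then [n] ways once [i] is known. *)
Lemma covered_bigcup (I T : eqType) (D : set I) (F : I -> set T) (m n : nat) :
  covered D m -> (forall i, D i -> covered (F i) n) ->
  covered (\bigcup_(i in D) F i) (m * n).
Proof.
move=> [r rm Dr] Fn.
have /choice [u uP] : forall i : I, exists u : seq T,
    (size u <= n)%N /\ (D i -> forall x, F i x -> x \in u).
  move=> i; have [Di|nDi] := pselect (D i); last by exists [::].
  by have [u un Fu] := Fn i Di; exists u.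
exists (flatten [seq u i | i <- r]).
  apply: leq_trans (_ : size r * n <= _)%N; last by rewrite leq_mul2r rm orbT.
  elim: r {rm Dr} => //= i r IH; rewrite size_cat mulSn leq_add //.
  by have [] := uP i.
move=> x [i Di Fix]; apply/flattenP; exists (u i); first exact/map_f/Dr.
by have [_ /(_ Di)] := uP i; apply.
Qed.

Lemma covered_tuple (T : eqType) (s : nat)
    (A : 'I_s -> set T) (n : 'I_s -> nat) :
  (forall i, covered (A i) (n i)) ->
  covered [set t : s.-tuple T | forall i, A i (tnth t i)] (\prod_(i < s) n i).
Proof.
elim: s A n => [|s IH] A n An.
  by exists [:: [tuple]]; rewrite ?big_ord0// => t _; rewrite tuple0 inE.
rewrite big_ord_recl.
apply: covered_sub (leqnn _)
  (covered_bigcup (F := fun x => [set [tuple of x :: t] | t in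
     [set t : s.-tuple T | forall i, A (lift ord0 i) (tnth t i)]]) (An ord0) _).
  move=> t At; exists (thead t); first exact: At.
  exists [tuple of behead t]; last by rewrite [RHS]tuple_eta.
  by move=> i /=; rewrite tnth_behead -[inord _](_ : lift ord0 i = _)//;
    apply: val_inj; rewrite /= inordK// ltnS.
move=> x _; apply: covered_image.
exact: (IH (fun i => A (lift ord0 i)) (fun i => n (lift ord0 i))).
Qed.

Lemma covered_fset (T : choiceType) (A : set T) (n : nat) :
  covered A n -> finite_set A /\ (#|` fset_set A| <= n)%N.
Proof.
move=> [r rn Ar].
have fA : finite_set A by apply: sub_finite_set (finite_seq r) => x /Ar.
split => //; apply: leq_trans rn.
apply: leq_trans (_ : #|` seq_fset tt r| <= _)%N; last first.
  by rewrite size_seq_fset size_undup.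
apply: fsubset_leq_card; apply/fsubsetP => x.
by rewrite in_fset_set// inE seq_fsetE => /Ar.
Qed.

(** * Integers with prescribed prime divisors *)

(** The integer part of the [k]-th root of [n], for [0 < k]. *)
Definition rootn (k n : nat) : nat := \max_(m < n.+1 | (m ^ k <= n)%N) m.

Lemma expn_rootn (k n : nat) : (0 < k)%N -> (rootn k n ^ k <= n)%N.
Proof.
move=> k0; rewrite /rootn.
have [|i] := eq_bigmax_cond (fun m : 'I_n.+1 => m : nat)
    (A := [pred m : 'I_n.+1 | (m ^ k <= n)%N]).
  by apply/card_gt0P; exists ord0; rewrite inE/= exp0n.
by rewrite inE => ? ->.
Qed.

Lemma leq_rootn (k m n : nat) :
  (0 < k)%N -> (m ^ k <= n)%N -> (m <= rootn k n)%N.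
Proof.
move=> k0 mkn.
have mn : (m < n.+1)%N.
  rewrite ltnS; apply: leq_trans mkn.
  by case: m => // m; rewrite -[X in (X <= _)%N]expn1 leq_pexp2l.
exact: (@leq_bigmax_cond _ _ (fun m : 'I_n.+1 => m : nat) (Ordinal mn)).
Qed.

Lemma prod_primes_logn (Q n : nat) : \pi(Q).-nat n ->
  n = (\prod_(p <- primes Q) p ^ logn p n)%N.
Proof.
move=> nQ; rewrite -[LHS](part_pnat_id nQ).
rewrite (@widen_partn (maxn n Q)) ?leq_maxl// -big_filter.
apply: perm_big; apply: uniq_perm; rewrite ?primes_uniq//.
  by rewrite filter_uniq// iota_uniq.
move=> p; rewrite mem_filter mem_index_iota/=.
apply: andb_idr => /[dup] pQ; rewrite mem_primes => /and3P[_ Q0 pdQ].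
by rewrite ltnS leq_max (dvdn_leq Q0 pdQ) orbT.
Qed.

(** The primes at least [K] contribute at most their own product to
    [K ^ size (primes Q)], and there are at most [K] smaller ones. *)
Lemma exp_size_primes (K Q : nat) : (0 < K)%N -> (0 < Q)%N ->
  (K ^ size (primes Q) <= K ^ K * Q)%N.
Proof.
move=> K0 Q0; set r := primes Q.
have Kr : (K ^ size r = \prod_(p <- r) K)%N.
  by rewrite big_const_seq iter_muln_1 count_predT.
have small : (\prod_(p <- r) (if p < K then K else 1) <= K ^ K)%N.
  rewrite -big_mkcond big_const_seq iter_muln_1 leq_pexp2l// -size_filter.
  rewrite -[leqRHS](size_iota 0); apply: uniq_leq_size.
    by rewrite filter_uniq// primes_uniq.
  by move=> p; rewrite mem_filter mem_iota => /andP[].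
have rad : (\prod_(p <- r) p <= Q)%N.
  rewrite [leqRHS](prod_primes_logn (pnat_pi Q0)) big_seq [leqRHS]big_seq.
  apply: leq_prod => p pr.
  have := pr; rewrite -logn_gt0 => l0; rewrite -[leqLHS]expn1 leq_pexp2l//.
  by move: pr; rewrite mem_primes => /andP[/prime_gt0].
rewrite Kr; apply: leq_trans (leq_mul small rad); rewrite -big_split/=.
rewrite big_seq [leqRHS]big_seq; apply: leq_prod => p; rewrite mem_primes.
have [_|Kp] := ltnP p K => [/andP[/prime_gt0 p0 _]|_]; last by rewrite mul1n.
by rewrite leq_pmulr.
Qed.

(** Each such [n] is [m ^ k * r] where every exponent in [r] is less than [k]:
    there are at most [X ^ (1 / k)] values of [m] and [k ^ size (primes Q)]
    values of [r].  With [K = k ^ k], the [k]-th power of the latter number is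
    [K ^ size (primes Q)], which [exp_size_primes] bounds.  For large [k]
    this is the statement that there are [(X * Q) ^ o(1)] such integers; it
    contains the divisor bound, as divisors of [Q] are of this form. *)
Lemma covered_pi_nat (k X Q : nat) : (0 < k)%N -> (0 < Q)%N ->
  covered [set n | (n <= X)%N /\ \pi(Q).-nat n]
    (rootn k ((k ^ k) ^ (k ^ k) * X * Q)).
Proof.
move=> k0 Q0; set w := size (primes Q).
have kk0 : (0 < k ^ k)%N by rewrite expn_gt0 k0.
have roots : covered [set m | (0 < m)%N /\ (m ^ k <= X)%N] (rootn k X).
  exists (iota 1 (rootn k X)); first by rewrite size_iota.
  by move=> m [m0 mX]; rewrite mem_iota m0 add1n ltnS leq_rootn.
pose f (e : {ffun 'I_w -> 'I_k}) := (\prod_(i < w) nth 0%N (primes Q) i ^ e i)%N.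
have kfree : covered (range f) (k ^ w).
  exists (codom f); first by rewrite size_codom card_ffun !card_ord.
  by move=> _ [e _ <-]; apply: codom_f.
apply: covered_sub _ _
  (covered_bigcup (F := fun m => [set (m ^ k * r)%N | r in range f]) roots
     (fun m _ => covered_image _ kfree)); last first.
  apply: leq_rootn => //; rewrite expnMn -expnM mulnC [(w * k)%N]mulnC expnM.
  by rewrite mulnAC leq_mul ?expn_rootn ?exp_size_primes.
move=> n [nX nQ].
have n0 : (0 < n)%N by case/andP: nQ.
pose m := (\prod_(p <- primes Q) p ^ (logn p n %/ k))%N.
pose r := (\prod_(p <- primes Q) p ^ (logn p n %% k))%N.
have nmr : n = (m ^ k * r)%N.
  rewrite [LHS](prod_primes_logn nQ) /m /r unstable.expn_prod -big_split/=.
  by apply: eq_bigr => p _; rewrite -expnM -expnD -divn_eq.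
have [m0 r0] : (0 < m)%N /\ (0 < r)%N.
  by apply/andP; move: n0; rewrite nmr muln_gt0 expn_gt0 (gtn_eqF k0) orbF.
exists m; first split => //.
  by apply: leq_trans nX; rewrite [leqRHS]nmr leq_pmulr.
exists r => //.
exists [ffun i : 'I_w =>
  Ordinal (ltn_pmod (logn (nth 0%N (primes Q) i) n) k0)] => //.
by rewrite /f /r (big_nth 0%N) big_mkord; apply: eq_bigr => i _; rewrite ffunE.
Qed.

(** * Symmetric integer matrices *)

Lemma covered_absz (S : set nat) (n : nat) :
  covered S n -> covered [set z : int | S `|z|%N] (2 * n).
Proof.
move=> Sn; rewrite mul2n -addnn; apply: covered_sub _ (leqnn _)
  (covered_setU (covered_image Posz Sn) (covered_image (fun m => - m%:Z) Sn)).
by move=> z Sz; have [z0|z0] := lerP 0 z; [left|right]; exists `|z|%N => //; lia.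
Qed.

Lemma covered_absz_le (B : nat) :
  covered [set z : int | (`|z| <= B)%N] (2 * B).+1.
Proof.
exists ([seq m%:Z | m <- iota 0 B.+1] ++ [seq - m%:Z | m <- iota 1 B]).
  by rewrite size_cat !size_map !size_iota; lia.
move=> z zB; have {}zB : (`|z| <= B)%N := zB.
rewrite mem_cat; apply/orP; have [z0|z0] := lerP 0 z.
  by left; apply/mapP; exists `|z|%N; [rewrite mem_iota; lia|lia].
by right; apply/mapP; exists `|z|%N; [rewrite mem_iota; lia|lia].
Qed.

Lemma covered_sqr_eq (d : int) : covered [set z : int | z ^+ 2 = d] 2.
Proof.
have [[x xd]|nx] := pselect (exists x : int, x ^+ 2 = d).
  exists [:: x; - x] => // z /= zd.
  by rewrite !inE -eqf_sqr zd xd.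
by exists [::] => // z zd; exfalso; apply: nx; exists z.
Qed.

Definition sym2 (a b c : int) : 'M[int]_2 :=
  \matrix_(i, j) if i == j then (if i == 0 then a else c) else b.

Lemma sym2E (A : 'M[int]_2) : A^T = A -> A = sym2 (A 0 0) (A 0 1) (A 1 1).
Proof.
move=> AT; have A10 : A 1 0 = A 0 1 by rewrite -{1}AT mxE.
apply/matrixP => -[[|[|//]] i2] [[|[|//]] j2]; rewrite mxE/=.
- by congr (A _ _); apply: val_inj.
- by congr (A _ _); apply: val_inj.
- by rewrite -A10; congr (A _ _); apply: val_inj.
- by congr (A _ _); apply: val_inj.
Qed.

Lemma det_sym2 (a b c : int) : \det (sym2 a b c) = a * c - b ^+ 2.
Proof.
rewrite (expand_det_row _ 0) !big_ord_recl big_ord0 /cofactor !det_mx11 !mxE/=.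
by ring.
Qed.

Lemma leq_mx_height (A : 'M[int]_2) (i j : 'I_2) : (`|A i j| <= mx_height A)%N.
Proof.
rewrite /mx_height; apply: leq_trans (leq_maxr _ _).
by apply: leq_trans (leq_bigmax i); apply: (leq_bigmax j).
Qed.

Definition sym_le (B : nat) : set 'M[int]_2 :=
  [set A | A^T = A /\ (mx_height A <= B)%N].

Lemma covered_sym_le (B : nat) : covered (sym_le B) ((2 * B).+1 ^ 3).
Proof.
have cB := covered_absz_le B.
apply: covered_sub _ _ (covered_bigcup cB (fun a _ => covered_bigcup cB
  (fun b _ => covered_image (sym2 a b) cB))); last by rewrite !expnS muln1.
move=> A [AT AB]; have AijB i j := leq_trans (leq_mx_height A i j) AB.
exists (A 0 0); first exact: AijB.
exists (A 0 1); first exact: AijB.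
by exists (A 1 1); [exact: AijB|rewrite -sym2E].
Qed.

Lemma absz_det_le (A : 'M[int]_2) (B : nat) :
  sym_le B A -> (`|\det A| <= 2 * B ^ 2)%N.
Proof.
move=> [AT AB]; have AijB i j := leq_trans (leq_mx_height A i j) AB.
rewrite [A in \det A]sym2E// det_sym2.
have := leq_mul (AijB 0 0) (AijB 1 1); have := leq_mul (AijB 0 1) (AijB 0 1).
by rewrite -!abszM -mulnn -expr2; lia.
Qed.

(** If [a c != 0], the entry [b] is free and [a] is a divisor of the nonzero
    integer [D + b ^ 2], which then determines [c].  If [a c = 0], then
    every [a] is a divisor of [D + b ^ 2 = 0], but [b ^ 2 = - D] leaves at most
    two values of [b], one of [a] and [c] is zero and the other one is free. *)
Lemma covered_sym_det (B N : nat) (D : int) : (0 < N)%N ->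
  (forall Q, (0 < Q <= B ^ 2)%N ->
     covered [set n | (n <= B)%N /\ \pi(Q).-nat n] N) ->
  covered [set A | sym_le B A /\ \det A = D] (6 * (2 * B).+1 * N).
Proof.
move=> N0 HN; have cB := covered_absz_le B.
pose W := (2 * B).+1.
have nonzero : covered
    [set A | [/\ sym_le B A, \det A = D & A 0 0 * A 1 1 != 0]] (W * (2 * N)).
  pose I := [set b : int | (`|b| <= B)%N /\ (0 < `|(D + b ^+ 2)%R| <= B ^ 2)%N].
  pose F b := [set sym2 a b ((D + b ^+ 2) %/ a)%Z | a in
    [set a | (`|a| <= B)%N /\ \pi(`|(D + b ^+ 2)%R|%N).-nat `|a|%N]].
  apply: covered_sub (_ : _ `<=` \bigcup_(b in I) F b) (leqnn _) _; last first.
    apply: covered_bigcup; first by apply: covered_sub cB => // b [].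
    by move=> b [_ /HN/covered_absz]; apply: covered_image.
  move=> A [[AT AB] detA ac0].
  have AijB i j := leq_trans (leq_mx_height A i j) AB.
  have acE : D + A 0 1 ^+ 2 = A 0 0 * A 1 1.
    by rewrite -detA [A in \det A]sym2E// det_sym2 subrK.
  exists (A 0 1).
    split; first exact: AijB.
    by rewrite acE absz_gt0 ac0 abszM /= leq_mul.
  move: ac0; rewrite mulf_eq0 negb_or => /andP[a0 c0].
  exists (A 0 0).
    split; first exact: AijB.
    rewrite acE; apply: (@pnat_dvd _ `|(A 0 0 * A 1 1)%R|%N).
      by rewrite abszM dvdn_mulr.
    by rewrite pnat_pi// absz_gt0 mulf_neq0.
  by rewrite acE mulKz// -sym2E.
have zero : covered
    [set A | [/\ sym_le B A, \det A = D & A 0 0 * A 1 1 = 0]] (2 * (W + W)).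
  apply: covered_sub _ (leqnn _) (covered_bigcup (covered_sqr_eq (- D))
    (fun b _ => covered_setU (covered_image (sym2 0 b) cB)
                             (covered_image (fun a => sym2 a b 0) cB))).
  move=> A [[AT AB] detA ac0].
  have AijB i j := leq_trans (leq_mx_height A i j) AB.
  exists (A 0 1).
    by rewrite /= -detA [A in \det A]sym2E// det_sym2 ac0 sub0r opprK.
  move/eqP: ac0; rewrite mulf_eq0 => /orP[]/eqP z.
    by left; exists (A 1 1); [exact: AijB|rewrite -z -sym2E].
  by right; exists (A 0 0); [exact: AijB|rewrite -z -sym2E].
apply: covered_sub _ _ (covered_setU nonzero zero).
  by move=> A [AB detA]; have [ac0|ac0] := eqVneq (A 0 0 * A 1 1) 0;
    [right|left].
(* The two cases give [2 * W * N] and [4 * W]. *)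
by rewrite -/W; nia.
Qed.

(** There are at most [2 * N] possible determinants, by the assumption on
    [N], and each is reached by few matrices thanks to [covered_sym_det]. *)
Lemma covered_sym_pi (B N U Q : nat) : (0 < Q <= U)%N -> (B ^ 2 <= U)%N ->
  (0 < N)%N ->
  (forall Q', (0 < Q' <= U)%N ->
     covered [set n | (n <= 2 * B ^ 2)%N /\ \pi(Q').-nat n] N) ->
  covered [set A | sym_le B A /\ \pi(Q).-nat `|\det A|%N]
    (12 * (2 * B).+1 * N ^ 2).
Proof.
move=> QU BU N0 HN.
pose F D := [set A | sym_le B A /\ \det A = D].
apply: covered_sub (_ : _ `<=` \bigcup_(D in _) F D) _
  (covered_bigcup (n := 6 * (2 * B).+1 * N) (covered_absz (HN Q QU)) _).
- by move=> A [AB AQ]; exists (\det A) => //; split => //; exact: absz_det_le.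
- by nia.
move=> D _; apply: covered_sym_det => // Q' /andP[Q'0 Q'B].
apply: covered_sub (leqnn _) (HN Q' _); last by rewrite Q'0 (leq_trans Q'B).
by move=> n [nB nQ']; split => //; nia.
Qed.

(** * Multiplicative relations and determinants *)

(** Dropping the factors with exponent [0] keeps the product, so it would
    turn a relation into one satisfied by a shorter subtuple. *)
Lemma exponents_neq0 (s : nat) (A : s.-tuple 'M[int]_2) (k : 'I_s -> int) :
  (forall (t : nat) (B : t.-tuple 'M[int]_2),
     (1 <= t < s)%N -> subseq B A -> ~ mult_dependent B) ->
  (exists i, k i != 0) ->
  \prod_(i < s) (map_mx intr (tnth A i) : 'M[rat]_2) ^ k i = 1 ->
  forall i, k i != 0.
Proof.
move=> minA [i0 ki0] prod1 i; apply/negP => /eqP ki.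
pose r := [seq j <- enum 'I_s | k j != 0].
have r1 : (1 <= size r < s)%N.
  apply/andP; split.
    by rewrite lt0n size_eq0 -has_filter; apply/hasP; exists i0; rewrite ?mem_enum.
  rewrite size_filter -[X in (_ < X)%N](size_enum_ord s) ltn_neqAle count_size andbT.
  by rewrite -all_count; apply/allPn; exists i; rewrite ?mem_enum ?ki.
apply: (minA _ (map_tuple (tnth A) (in_tuple r)) r1) => /=.
  rewrite -[X in subseq _ X](map_tnth_enum A).
  exact/map_subseq/filter_subseq.
exists (fun j => k (tnth (in_tuple r) j)); split.
  have /andP[r0 _] := r1.
  exists (Ordinal r0); have := mem_tnth (Ordinal r0) (in_tuple r).
  by rewrite mem_filter => /andP[].
under eq_bigr do rewrite tnth_map.
rewrite -(big_tnth _ _ r predT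
  (fun j => (map_mx intr (tnth A j) : 'M[rat]_2) ^ k j)) big_filter enumT.
rewrite -[RHS]prod1 [LHS]big_mkcond/=; apply: eq_bigr => j _.
by case: eqP => [->|//]; rewrite expr0z.
Qed.

Lemma det_exprz (F : fieldType) (n : nat) (M : 'M[F]_n.+1) (z : int) :
  \det (M ^ z) = \det M ^ z.
Proof.
have detX (m : nat) : \det (M ^+ m) = \det M ^+ m.
  elim: m => [|m IH]; first by rewrite !expr0 det1.
  by rewrite !exprS -IH -det_mulmx.
by case: z => m; rewrite -?exprnP ?NegzE -?exprnN ?det_inv detX.
Qed.

(** Determinants are multiplicative up to inverses over [rat], and absolute
    values turn both sides into products of natural numbers, to which unique
    factorization applies. *)
Lemma prod_det_eq (s : nat) (A : s.-tuple 'M[int]_2) (k : 'I_s -> int) :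
  \prod_(i < s) (map_mx intr (tnth A i) : 'M[rat]_2) ^ k i = 1 ->
  (\prod_(i < s | (0 <= k i)%R) `|\det (tnth A i)| ^ `|k i| =
   \prod_(i < s | ~~ (0 <= k i)%R) `|\det (tnth A i)| ^ `|k i|)%N.
Proof.
move=> prod1; pose d i := `|\det (tnth A i)|%N.
have : \prod_(i < s) ((d i)%:R : rat) ^ k i = 1.
  have := congr1 (fun M => `|\det M|) prod1; rewrite det1 normr1.
  rewrite (big_morph _ (@det_mulmx _ _) (det1 _ _)) normr_prod => norm1.
  rewrite -[RHS]norm1.
  apply: eq_bigr => i _; rewrite det_exprz det_map_mx.
  rewrite -[(d i)%:R](_ : `|(\det (tnth A i))%:~R| = _); last first.
    by rewrite -intr_norm -natr_absz.
  by case: (k i) => m; rewrite ?NegzE -?exprnN -?exprnP ?normfV normrX.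
rewrite (bigID (fun i => 0 <= k i))/= => /eqP.
under [X in _ * X == _]eq_bigr => i ki.
  have -> : k i = - (`|k i|%N : int) by move: ki; lia.
  rewrite -exprnN; over.
rewrite prodfV /=.
under eq_bigr => i ki.
  have -> : k i = (`|k i|%N : int) by move: ki; lia.
  rewrite -exprnP; over.
move/eqP/divr1_eq => eqd.
apply/eqP; rewrite -(eqr_nat rat) !natr_prod; apply/eqP.
under eq_bigr do rewrite natrX.
by under [RHS]eq_bigr do rewrite natrX.
Qed.

(** A prime divisor of [d i] divides the left-hand side, hence the right-hand
    side, hence one of its factors. *)
Lemma pi_nat_of_prod_eq (I : finType) (P : pred I) (d e : I -> nat) :
  (forall i, 0 < d i)%N -> (forall i, 0 < e i)%N ->
  (\prod_(i | P i) d i ^ e i = \prod_(i | ~~ P i) d i ^ e i)%N ->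
  forall i, P i -> \pi((\prod_(j | ~~ P j) d j)%N).-nat (d i).
Proof.
move=> d0 e0 deq i Pi; set Q := (\prod_(j | ~~ P j) d j)%N.
have Q0 : (0 < Q)%N by apply: prodn_gt0.
have : \pi(Q).-nat (\prod_(j | ~~ P j) d j ^ e j)%N.
  apply: (big_ind (fun n => \pi(Q).-nat n)) => // [m n mQ nQ|j Pj].
    by rewrite pnatM mQ.
  rewrite pnatX (pnat_dvd (n := Q)) ?pnat_pi//.
  by rewrite /Q (bigD1 j)//= dvdn_mulr.
apply: pnat_dvd; rewrite -deq (bigD1 i)//=.
by rewrite dvdn_mulr// -[X in (X %| _)%N]expn1 dvdn_exp2l.
Qed.

(** The relation between determinants is symmetric in the indices of positive
    and of negative exponent, so either set can play the part of [J]; the one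
    with at most [s / 2] elements is taken. *)
Lemma min_mult_dependent_supp (R : realType) (s : nat) (c H : R)
    (A : s.-tuple 'M[int]_2) : min_mult_dependent s c H A ->
  exists2 J : {set 'I_s}, (2 * #|J| <= s)%N & forall i, i \notin J ->
    \pi((\prod_(j in J) `|\det (tnth A j)|)%N).-nat `|\det (tnth A i)|%N.
Proof.
move=> [symA [k [kex prod1]] minA].
have detA i : \det (tnth A i) != 0 by have [] := symA i.
have k0 := exponents_neq0 minA kex prod1.
have e0 i : (0 < `|k i|)%N by rewrite absz_gt0.
have d0 i : (0 < `|\det (tnth A i)|)%N by rewrite absz_gt0.
have deq := prod_det_eq prod1.
pose J := [set i | 0 <= k i]%SET.
have cardJ : (#|J| + #|~: J| = s)%N by rewrite cardsC card_ord.
have [Js|Js] := leqP (2 * #|J|) s.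
  exists J => // i; rewrite inE => ki.
  have deq' : (\prod_(i < s | ~~ (0 <= k i)%R) `|\det (tnth A i)| ^ `|k i| =
     \prod_(i < s | ~~ ~~ (0 <= k i)%R) `|\det (tnth A i)| ^ `|k i|)%N.
    by rewrite -deq; apply: eq_bigl => j; rewrite negbK.
  have := pi_nat_of_prod_eq d0 e0 deq' ki; congr (pnat (\pi(_)) _).
  by apply: eq_bigl => j; rewrite negbK inE.
have CJs : (2 * #|~: J| <= s)%N by lia.
exists (~: J) => //.
move=> i; rewrite !inE negbK => ki.
have := pi_nat_of_prod_eq d0 e0 deq ki; congr (pnat (\pi(_)) _).
by apply: eq_bigl => j; rewrite !inE.
Qed.

(** The set [J] stands in for the multiplicative relation itself, whose
    exponents are not bounded in terms of [B] and so cannot be enumerated. *)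
Definition half_supported (s B : nat) : set (s.-tuple 'M[int]_2) :=
  [set A | exists J : {set 'I_s}, [/\ (2 * #|J| <= s)%N,
    forall i, sym_le B (tnth A i) /\ \det (tnth A i) != 0 &
    forall i, i \notin J ->
      \pi((\prod_(j in J) `|\det (tnth A j)|)%N).-nat `|\det (tnth A i)|%N]].

Arguments half_supported s B : clear implicits.

(** A tuple is built by choosing [J], then a tuple [v] agreeing with it on
    [J] and zero elsewhere, then the entries outside [J], whose determinants are
    composed of primes determined by [v].  Each index of [J] costs [W ^ 3] and
    each other index [12 * W * N ^ 2]; as [2 * #|J| <= s], the exponent of
    [W] is [3 * #|J| + (s - #|J|) <= 2 * s]. *)
Lemma covered_half_supported (s B N : nat) : (0 < s)%N -> (0 < N)%N ->
  (forall Q, (0 < Q <= (2 * B).+1 ^ (2 * s))%N ->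
     covered [set n | (n <= 2 * B ^ 2)%N /\ \pi(Q).-nat n] N) ->
  covered (half_supported s B) (24 ^ s * (2 * B).+1 ^ (2 * s) * N ^ (2 * s)).
Proof.
move=> s0 N0 HN; set W := (2 * B).+1.
pose Q (v : s.-tuple 'M[int]_2) (J : {set 'I_s}) :=
  (\prod_(j in J) `|\det (tnth v j)|)%N.
pose V (J : {set 'I_s}) := [set v : s.-tuple 'M[int]_2 | forall i, if i \in J
  then sym_le B (tnth v i) /\ \det (tnth v i) != 0 else tnth v i = 0].
pose F (J : {set 'I_s}) v := [set A : s.-tuple 'M[int]_2 | forall i, if i \in J
  then tnth A i = tnth v i
  else sym_le B (tnth A i) /\ \pi(Q v J).-nat `|\det (tnth A i)|%N].
have VJ (J : {set 'I_s}) : covered (V J) ((W ^ 3) ^ #|J|).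
  have -> : ((W ^ 3) ^ #|J| = \prod_(i < s) (if i \in J then W ^ 3 else 1))%N.
    by rewrite -big_mkcond prod_nat_const.
  apply: (covered_tuple (A := fun i M => if i \in J
    then sym_le B M /\ \det M != 0 else M = 0)) => i.
  case: (i \in J); last by exists [:: 0] => // M ->; rewrite inE.
  by apply: covered_sub (leqnn _) (covered_sym_le B) => M [].
have FJ (J : {set 'I_s}) v : V J v ->
    covered (F J v) ((12 * W * N ^ 2) ^ #|~: J|).
  move=> Vv.
  have -> : ((12 * W * N ^ 2) ^ #|~: J| =
      \prod_(i < s) (if i \in J then 1 else 12 * W * N ^ 2))%N.
    rewrite -prod_nat_const big_mkcond.
    by apply: eq_bigr => i _; rewrite inE; case: (i \in J).
  apply: (covered_tuple (A := fun i M => if i \in J then M = tnth v i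
    else sym_le B M /\ \pi(Q v J).-nat `|\det M|%N)) => i.
  case: (i \in J); first by exists [:: tnth v i] => // M ->; rewrite inE.
  have BW : (2 * B ^ 2 <= W ^ 2)%N by rewrite /W; nia.
  apply: (covered_sym_pi (U := W ^ (2 * s))) => //; last first.
    apply: leq_trans (_ : W ^ 2 <= _)%N; first lia.
    by rewrite leq_pexp2l// leq_pmulr.
  apply/andP; split.
    rewrite prodn_cond_gt0// => j jJ; rewrite absz_gt0.
    by have := Vv j; rewrite jJ => -[].
  apply: (@leq_trans (\prod_(j in J) W ^ 2)%N).
    apply: leq_prod => j jJ; apply: leq_trans BW; apply: absz_det_le.
    by have := Vv j; rewrite jJ => -[].
  rewrite prod_nat_const -expnM leq_pexp2l// leq_mul2l/=.
  by rewrite -[X in (_ <= X)%N]card_ord max_card.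
pose D := [set J : {set 'I_s} | (2 * #|J| <= s)%N].
have DD : covered D (2 ^ s).
  exists (enum {set 'I_s}); last by move=> J _; rewrite mem_enum.
  by rewrite -cardE -cardsT -powersetT card_powerset cardsT card_ord.
apply: covered_sub _ _ (covered_bigcup (F := fun J => \bigcup_(v in V J) F J v)
  (n := 12 ^ s * W ^ (2 * s) * N ^ (2 * s)) DD _).
- move=> A [J [Js symA suppA]]; exists J => //.
  pose v := [tuple if i \in J then tnth A i else 0 | i < s].
  have vJ i : i \in J -> tnth v i = tnth A i by rewrite tnth_mktuple => ->.
  exists v => i; case: ifPn => iJ.
  + by rewrite vJ.
  + by rewrite tnth_mktuple (negbTE iJ).
  + by rewrite vJ.
  have [symAi _] := symA i; split => //; have := suppA i iJ.
  by congr (pnat (\pi(_)) _); apply: eq_bigr => j /vJ ->.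
- by rewrite -[24%N]/(2 * 12)%N expnMn !mulnA.
move=> J Js; apply: covered_sub _ _ (covered_bigcup (VJ J) (@FJ J)); first by [].
have cardJ : (#|J| + #|~: J| = s)%N by rewrite cardsC card_ord.
set a := #|J|; set b := #|~: J|.
rewrite -expnM 2!expnMn -[((N ^ 2) ^ b)%N]expnM.
have -> : (W ^ (3 * a) * (12 ^ b * W ^ b * N ^ (2 * b)) =
    12 ^ b * W ^ (3 * a + b) * N ^ (2 * b))%N by rewrite expnD; ring.
by rewrite !leq_mul// leq_pexp2l//; move: Js; rewrite /D/= -/a; lia.
Qed.

(** * The asymptotic bound *)

(** Here [k] is chosen as a multiple of [2 * s] so that the factor
    [N ^ (2 * s)] of the count satisfies
    [(N ^ (2 * s)) ^ m <= M * W ^ (2 * s + 2)], which bounds it by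
    [W ^ ((2 * s + 2) / m)] up to a constant. *)
Lemma covered_min_mult_dependent (R : realType) (s m : nat) (c H : R) :
  (0 < s)%N -> (0 < m)%N -> 0 <= c * H ->
  let W := (2 * Num.truncn (c * H)).+1 in
  let k := (2 * s * m)%N in
  let N := rootn k ((k ^ k) ^ (k ^ k) * W ^ (2 * s + 2)) in
  covered (min_mult_dependent s c H) (24 ^ s * W ^ (2 * s) * N ^ (2 * s)).
Proof.
move=> s0 m0 cH0 W k N; pose B := Num.truncn (c * H).
have k0 : (0 < k)%N by rewrite !muln_gt0 s0 m0.
have kk0 : (0 < (k ^ k) ^ (k ^ k))%N by rewrite !expn_gt0 k0.
have N0 : (0 < N)%N by rewrite leq_rootn// exp1n muln_gt0 kk0 expn_gt0.
apply: covered_sub _ (leqnn _) (covered_half_supported (B := B) s0 N0 _).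
  move=> A minA; have [J Js suppA] := min_mult_dependent_supp minA.
  exists J; split => // i; have [/(_ i)[symA detA hA] _ _] := minA.
  by split => //; split => //; rewrite truncn_ge_nat.
move=> Q /andP[Q0 QW].
apply: covered_sub _ _ (covered_pi_nat (2 * B ^ 2) k0 Q0); first by [].
apply: leq_rootn => //; apply: leq_trans (expn_rootn _ k0) _.
rewrite -mulnA leq_mul// addnC expnD leq_mul//.
by rewrite /W -/B; nia.
Qed.

(** In the count of [covered_min_mult_dependent], the factor [W ^ (2 * s)] gives
    the main term; taking [m] at least [(2 * s + 2) / eps] makes
    [N ^ (2 * s)] at most [K * H `^ eps]. *)
Theorem proposition25 (R : realType) (s : nat) (hs : (1 <= s)%N)
    (c : R) (hc : 0 < c) (eps : R) (heps : 0 < eps) :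
  exists C : R, 0 < C /\
    forall H : R, 1 <= H ->
      finite_set (min_mult_dependent s c H) /\
      (#|` fset_set (min_mult_dependent s c H)|%fset)%:R
        <= C * H `^ ((2 * s)%:R + eps).
Proof.
pose m := (Num.truncn ((2 * s + 2)%:R / eps)).+1.
have meps : (2 * s + 2)%:R <= eps * m%:R.
  by rewrite mulrC -ler_pdivrMr// ltW// truncnS_gt.
pose k := (2 * s * m)%N; pose M := ((k ^ k) ^ (k ^ k))%N.
have M1 : 1 <= M%:R :> R.
  by rewrite ler1n !expn_gt0 !muln_gt0 hs.
pose a : R := 2 * c + 1; have a1 : 1 <= a by rewrite /a; lra.
pose K := M%:R * a ^+ (2 * s + 2).
have K1 : 1 <= K by rewrite mulr_ege1// exprn_ege1.
exists (24 ^+ s * a ^+ (2 * s) * K); split.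
  by rewrite !mulr_gt0// ?exprn_gt0//; lra.
move=> H H1; have H0 : 0 <= H by lra.
have cH0 : 0 <= c * H by rewrite mulr_ge0// ltW.
have [finA cardA] :=
  covered_fset (covered_min_mult_dependent hs (ltn0Sn _ : (0 < m)%N) cH0).
split => //; move: cardA; rewrite -/k -/M.
set W := (2 * _).+1; set N := rootn _ _ => cardA.
(* As [1 <= H], the additive constant in [W] is absorbed by [H]. *)
have WaH : W%:R <= a * H.
  have : (Num.truncn (c * H))%:R <= c * H by rewrite truncn_le.
  by rewrite /W /a -natr1 natrM; lra.
have NH : N%:R ^+ (2 * s) <= K * H `^ eps.
  have KH0 : 0 <= K * H `^ eps by apply: mulr_ge0; [lra|exact: powR_ge0].
  rewrite -(@ler_pXn2r _ m)// ?nnegrE ?exprn_ge0//.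
  rewrite -exprM -natrX; apply: (@le_trans _ _ (M * W ^ (2 * s + 2))%:R).
    by rewrite ler_nat expn_rootn// !muln_gt0 hs.
  apply: (@le_trans _ _ (K * H ^+ (2 * s + 2))).
    rewrite natrM natrX /K -mulrA -exprMn ler_pM2l; last by lra.
    by rewrite lerXn2r// nnegrE// mulr_ge0//; lra.
  rewrite exprMn ler_pM ?exprn_ge0//; first lra.
    by rewrite ler_eXnr.
  rewrite -!powR_mulrn ?powR_ge0// -powRrM; exact: ler_powR.
apply: (@le_trans _ _ (24 ^ s * W ^ (2 * s) * N ^ (2 * s))%:R).
  by rewrite ler_nat.
rewrite powRD; last by apply/implyP => _; lra.
rewrite powR_mulrn// !natrM !natrX.
have -> : 24 ^+ s * a ^+ (2 * s) * K * (H ^+ (2 * s) * H `^ eps) =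
    24 ^+ s * (a * H) ^+ (2 * s) * (K * H `^ eps) by rewrite exprMn; ring.
have WH : W%:R ^+ (2 * s) <= (a * H) ^+ (2 * s).
  by rewrite lerXn2r ?nnegrE// mulr_ge0//; lra.
apply: ler_pM => //; rewrite ?mulr_ge0 ?exprn_ge0//.
by rewrite ler_pM2l// exprn_gt0.
Qed.
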